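(* Let $(a,b)\in(1/4,1/2)\times(1/2,3/4)$. If $b-a<\frac16$, then $(a,b)\in D_2$, and the constant $\frac16$ cannot be improved (i.e. replaced by any larger constant). If $(a,b)\in D_2$, then $b-a<\frac14$, and the constant $\frac14$ cannot be improved (i.e. replaced by any smaller constant).
   Context: Let $T:[0,1]\to[0,1]$ be the doubling map: $Tx=2x$ for $x\in[0,1/2]$ and $Tx=2x-1$ for $x\in(1/2,1]$. An $n$-cycle is a periodic orbit of $T$ of prime (least) period $n$. For $a<b$, an integer $n\ge 3$ is called bad for $(a,b)$ if every $n$-cycle of $T$ has non-empty intersection with the open interval $(a,b)$. $B(a,b)$ denotes the set of all $n\ge3$ which are bad for $(a,b)$, and $D_2=\{(a,b)\in(1/4,1/2)\times(1/2,3/4): B(a,b)\text{ is finite}\}$. *)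

(* Defs.v *)
From mathcomp Require Import all_boot all_order all_algebra.
From mathcomp Require Import all_classical all_reals all_analysis.

Set Implicit Arguments.
Unset Strict Implicit.
Unset Printing Implicit Defensive.

Import Order.TTheory GRing.Theory Num.Theory.
Local Open Scope classical_set_scope.
Local Open Scope ring_scope.

(* The doubling map, as a total function on [R]; only its restriction to
   [0, 1], which it maps to itself, is used. *)
Definition doubling (R : realType) (x : R) : R :=
  if x <= 1 / 2 then 2 * x else 2 * x - 1.

Definition least_period (T : Type) (f : T -> T) (n : nat) (x : T) : Prop :=
  [/\ (0 < n)%N, iter n f x = x &
      forall m : nat, (0 < m < n)%N -> iter m f x <> x].

Definition is_cycle (R : realType) (n : nat) (C : set R) : Prop :=
  exists x : R, [/\ x \in `[0, 1], least_period (@doubling R) n x &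
    C = range (fun k : nat => iter k (@doubling R) x)].

Definition bad (R : realType) (a b : R) (n : nat) : Prop :=
  forall C : set R, is_cycle n C -> C `&` `]a, b[ !=set0.

Definition badset (R : realType) (a b : R) : set nat :=
  [set n | (3 <= n)%N /\ bad a b n].

Definition box (R : realType) : set (R * R) :=
  `]1 / 4, 1 / 2[ `*` `]1 / 2, 3 / 4[.

Definition D2 (R : realType) : set (R * R) :=
  [set p | box p /\ finite_set (badset p.1 p.2)].

(* Main.v *)
(* If 1/3 <= a and b < 7/12, the hole is avoided by cycles that leave the 2-cycle
   {1/3, 2/3} very slowly and come back to it after one or two excursions; these
   have every large period, which gives D_2 for b - a < 1/6 (up to the symmetry
   x -> 1 - x) and, with a = 1/3 and b -> 7/12, the sharpness of 1/4.
   For the hole (5/12, 7/12) of length 1/6, the condition |x - 1/2| < 1/6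
   alternates along every other cycle avoiding it, so all odd n are bad.
   If b - a >= 1/4, a cycle avoiding (a, b) lies in [2b - 1, 2a], of length at
   most 1/2, on which doubling preserves the cyclic order; hence all such cycles
   have the same proportion of binary digits 1, strictly between 0 and 1, which
   cannot be a fraction with denominator n and also one with denominator n + 1. *)

Require Import Defs.
From mathcomp Require Import all_boot all_order all_algebra.
From mathcomp Require Import all_classical all_reals all_analysis.
From mathcomp Require Import ring lra zify.

Set Implicit Arguments.
Unset Strict Implicit.
Unset Printing Implicit Defensive.

Import Order.TTheory GRing.Theory Num.Theory.
Local Open Scope classical_set_scope.
Local Open Scope ring_scope.

(** * Doubling and periodic orbits *)

Lemma doubling_low (R : realType) (x : R) : x <= 1 / 2 -> doubling x = 2 * x.
Proof. by rewrite /doubling => ->. Qed.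

Lemma doubling_high (R : realType) (x : R) :
  1 / 2 < x -> doubling x = 2 * x - 1.
Proof. by rewrite /doubling leNgt => ->. Qed.

Lemma iter_doubling_itv (R : realType) (x : R) (k : nat) :
  0 <= x <= 1 -> 0 <= iter k (@doubling R) x <= 1.
Proof.
move=> x01; elim: k => //= k; move: (iter _ _ _) => y y01.
by have [h|h] := leP y (1 / 2); [rewrite doubling_low|rewrite doubling_high] => //; lra.
Qed.

Lemma iter_modn_period (T : Type) (f : T -> T) (n : nat) (x : T) (k : nat) :
  iter n f x = x -> iter k f x = iter (k %% n) f x.
Proof.
move=> fx; rewrite {1}(divn_eq k n) addnC iterD; congr iter.
by elim: (k %/ n)%N => // q IH; rewrite mulSn iterD IH.
Qed.

(** Adding full turns of the cycle makes any time later than [m], so forward invariance reaches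
    every point. *)
Lemma periodic_forward_invariant (T : Type) (f : T -> T) (n m : nat) (x : T)
    (P : T -> Prop) :
  (m < n)%N -> iter n f x = x -> P (iter m f x) ->
  (forall i, P (iter i f x) -> P (iter i.+1 f x)) -> forall k, P (iter k f x).
Proof.
move=> mn fx Pm stay k.
have later l : P (iter (l + m) f x) by elim: l => // l /stay.
have := later (k + m * n - m)%N; rewrite subnK; last by nia.
by rewrite (iter_modn_period _ fx) addnC modnMDl -(iter_modn_period _ fx).
Qed.

(** * Cycles that avoid the hole *)

Definition avoiding (R : realType) (a b : R) (n : nat) (x : R) : Prop :=
  [/\ 0 <= x <= 1, least_period (@doubling R) n x &
      forall k, iter k (@doubling R) x <= a \/ b <= iter k (@doubling R) x].

Lemma not_bad (R : realType) (a b : R) (n : nat) :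
  ~ bad a b n <-> exists x, avoiding a b n x.
Proof.
split=> [nb|[x [x01 px hx]] /(_ (range (fun k => iter k (@doubling R) x)))].
  apply: contrapT => /forallNP none; apply: nb => C [x [x01 px ->]].
  apply: contrapT => hC; apply: (none x); split=> // k.
  have [|xa] := leP (iter k (@doubling R) x) a; first by left.
  have [|xb] := leP b (iter k (@doubling R) x); first by right.
  case: hC; exists (iter k (@doubling R) x).
  by split; [exists k|rewrite /= in_itv /= xa].
case; first by exists x.
move=> _ [[k _ <-]] /=; rewrite in_itv /= => /andP[h1 h2].
by case: (hx k) => h; lra.
Qed.

Lemma finite_set_natP (A : set nat) :
  finite_set A <-> exists N, forall n, A n -> (n < N)%N.
Proof.
split=> [/finite_seqP[s ->]|[N AN]].
  exists (\max_(i <- s) i).+1 => n /= ns.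
  by rewrite ltnS; apply: (@leq_bigmax_seq _ s xpredT id).
by apply: sub_finite_set (finite_II N) => n /AN.
Qed.

Lemma D2_eventually (R : realType) (a b : R) :
  D2 (a, b) <-> box (a, b) /\
    exists N, forall n, (N <= n)%N -> exists x, avoiding a b n x.
Proof.
split=> -[bx]; first move=> /finite_set_natP[N hN].
  split=> //; exists (maxn N 3) => n; rewrite geq_max => /andP[Nn n3].
  by apply/not_bad => bn; have := hN n (conj n3 bn); rewrite ltnNge Nn.
move=> [N hN]; split=> //; apply/finite_set_natP; exists N => n [_ bn].
by rewrite ltnNge; apply/negP => /hN/not_bad.
Qed.

(** * Cycles close to the 2-cycle {1/3, 2/3} *)

(* Near the 2-cycle 1/3 -> 2/3, the deviation from the cycle doubles at each
   step as long as both points have the same binary digit. *)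
Lemma iter_doubling_third (R : realType) (e : R) (i j : nat) :
  0 < e -> 4 ^+ j * e < 1 / 3 -> (i <= j)%N ->
  iter (2 * i) (@doubling R) (1 / 3 - e) = 1 / 3 - 4 ^+ i * e /\
  iter (2 * i).+1 (@doubling R) (1 / 3 - e) = 2 / 3 - 2 * (4 ^+ i * e).
Proof.
move=> e0 ej; have pos k : 0 < 4 ^+ k * e by rewrite mulr_gt0 ?exprn_gt0.
have step k (y : R) : y = 1 / 3 - 4 ^+ k * e ->
    doubling y = 2 / 3 - 2 * (4 ^+ k * e).
  by move=> ->; have h := pos k; rewrite doubling_low; lra.
elim: i => [_|i IH ij].
  by have := step 0%N (1 / 3 - e); rewrite muln0 expr0 (mul1r e) /= => ->.
have -> : (2 * i.+1)%N = (2 * i).+2 by lia.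
have [_ h] := IH (ltnW ij).
suff h2 : iter (2 * i).+2 (@doubling R) (1 / 3 - e) = 1 / 3 - 4 ^+ i.+1 * e.
  by split=> //; rewrite iterS h2 (step i.+1).
rewrite iterS h.
have : 4 ^+ i.+1 * e <= 4 ^+ j * e.
  by rewrite ler_pM2r // ler_weXn2l // ler1n.
rewrite exprS => h4; rewrite doubling_high; lra.
Qed.

(** The odd length makes the orbit end at a deviation measured from 1/3 instead of 2/3. The lowest
    odd-time point before the end is 2/3 - 4^j e / 2 = 7/12 - f / 4, whence the bound on [b]. *)
Lemma third_excursion (R : realType) (b e f : R) (j : nat) :
  0 < e -> 4 ^+ j * e < 1 / 3 -> f = 2 * (4 ^+ j * e) - 1 / 3 ->
  b <= 7 / 12 - f / 4 ->
  iter (2 * j).+1 (@doubling R) (1 / 3 - e) = 1 / 3 - f /\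
  (forall m, (0 < m < (2 * j).+1)%N ->
    iter m (@doubling R) (1 / 3 - e) < 1 / 3 - e \/
    b <= iter m (@doubling R) (1 / 3 - e)).
Proof.
move=> e0 ej fE bf; have orbit i := @iter_doubling_third _ e i j e0 ej.
split=> [|m /andP[m0 mj]]; first by rewrite (orbit j _).2 // fE; lra.
have [om|em] := boolP (odd m).
  have mE : m = (2 * m./2).+1 by lia.
  rewrite mE (orbit m./2 _).2; last by lia.
  have : 4 ^+ m./2.+1 * e <= 4 ^+ j * e.
    by rewrite ler_pM2r // ler_weXn2l ?ler1n //; lia.
  by rewrite exprS => h; right; lra.
have mE : m = (2 * m./2)%N by lia.
rewrite mE (orbit m./2 _).1; last by lia.
left; suff : 1 * e < 4 ^+ m./2 * e by lra.
by rewrite ltr_pM2r // exprn_egt1 ?ltr1n //; lia.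
Qed.

(** With [f = e] one excursion closes up; the points in between lie below the start or above 1/2, so
    the period is least. *)
Lemma avoiding_odd (R : realType) (a b e : R) (j : nat) :
  1 / 3 <= a -> 1 / 2 < b -> 0 < e -> 4 ^+ j * e < 1 / 3 ->
  e = 2 * (4 ^+ j * e) - 1 / 3 -> b <= 7 / 12 - e / 4 ->
  avoiding a b (2 * j).+1 (1 / 3 - e).
Proof.
move=> a3 b2 e0 ej eE be.
have [per exc] := third_excursion e0 ej eE be.
have e3 : e < 1 / 3 by lra.
split; [lra| split=> // m /exc[] h|move=> k]; [lra|lra|].
rewrite (iter_modn_period k per).
case: (posnP (k %% (2 * j).+1)) => [->|k0]; first by left => /=; lra.
have kj : (0 < k %% (2 * j).+1 < (2 * j).+1)%N by rewrite k0 ltn_mod.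
by case: (exc _ kj) => h; [left; lra|right].
Qed.

(** Two excursions of odd length give even periods; [e < f] puts the junction 1/3 - f strictly below
    the start. *)
Lemma avoiding_even (R : realType) (a b e f : R) (j k : nat) :
  1 / 3 <= a -> 1 / 2 < b -> 0 < e -> e < f ->
  4 ^+ j * e < 1 / 3 -> f = 2 * (4 ^+ j * e) - 1 / 3 ->
  4 ^+ k * f < 1 / 3 -> e = 2 * (4 ^+ k * f) - 1 / 3 ->
  b <= 7 / 12 - f / 4 ->
  avoiding a b ((2 * k).+1 + (2 * j).+1) (1 / 3 - e).
Proof.
move=> a3 b2 e0 ef ej fE fk eE bf; have f0 := lt_trans e0 ef.
have be : b <= 7 / 12 - e / 4 by lra.
have [perj excj] := third_excursion e0 ej fE bf.
have [perk exck] := third_excursion f0 fk eE be.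
have per : iter ((2 * k).+1 + (2 * j).+1) (@doubling R) (1 / 3 - e) = 1 / 3 - e.
  by rewrite iterD perj perk.
have exc m : (0 < m < (2 * k).+1 + (2 * j).+1)%N ->
    iter m (@doubling R) (1 / 3 - e) < 1 / 3 - e \/
    b <= iter m (@doubling R) (1 / 3 - e).
  move=> /andP[m0 mk]; have [mj|jm] := ltnP m (2 * j).+1.
    by apply: excj; rewrite m0.
  rewrite -(subnK jm) iterD perj.
  case: (posnP (m - (2 * j).+1)) => [->|m'0]; first by left => /=; lra.
  have m'k : (0 < m - (2 * j).+1 < (2 * k).+1)%N by lia.
  by case: (exck _ m'k) => h; [left; lra|right].
split; [lra| split=> // m /exc[] h; lra|move=> m].
rewrite (iter_modn_period m per).
case: (posnP (m %% ((2 * k).+1 + (2 * j).+1))) => [->|m0]; first by left => /=; lra.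
have mn : (0 < m %% ((2 * k).+1 + (2 * j).+1) < (2 * k).+1 + (2 * j).+1)%N.
  by rewrite m0 ltn_mod addSn.
by case: (exc _ mn) => h; [left; lra|right].
Qed.

Lemma eventually_avoiding (R : realType) (a b : R) :
  1 / 3 <= a -> 1 / 2 < b < 7 / 12 ->
  exists N, forall n, (N <= n)%N -> exists x, avoiding a b n x.
Proof.
move=> a3 /andP[b2 b7].
(* Deviations of at most 4^-k will then satisfy the bound on [b]. *)
have [k bk] : exists k : nat, b <= 7 / 12 - (4 ^+ k)^-1 / 4.
  have d0 : 0 < (4 * (7 / 12 - b))^-1 by rewrite invr_gt0; lra.
  exists (Num.bound (4 * (7 / 12 - b))^-1).
  have := archi_boundP (ltW d0); set k := Num.bound _ => hk.
  have : (4 * (7 / 12 - b))^-1 <= 4 ^+ k.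
    apply: le_trans (ltW hk) _; rewrite -natrX ler_nat.
    by apply/ltnW/ltn_expl.
  rewrite -[leRHS]invrK lef_pV2 ?posrE ?invr_gt0 ?exprn_gt0 //; last by lra.
  by lra.
exists (4 * k + 6)%N => n nk.
have B1 : 1 <= 4 ^+ k :> R by rewrite exprn_ege1 ?ler1n.
have Bi : (4 ^+ k)^-1 * 4 ^+ k = 1 :> R by rewrite mulVf //; lra.
set B := 4 ^+ k in bk B1 Bi *; set C := B^-1 in bk Bi *.
have [on|en] := boolP (odd n).
  have -> : n = (2 * n./2).+1 by lia.
  have AB : 4 * B <= 4 ^+ n./2.
    by rewrite -exprS ler_weXn2l ?ler1n //; lia.
  set A := 4 ^+ _ in AB.
  (* The solution of [e = 2 * (A * e) - 1 / 3]. *)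
  pose e := (3 * (2 * A - 1))^-1.
  have De : 0 < 3 * (2 * A - 1) by lra.
  have eE : e * (3 * (2 * A - 1)) = 1 by rewrite mulVf //; lra.
  have e0 : 0 < e by rewrite invr_gt0.
  have eC : e <= C by rewrite lef_pV2 ?posrE; lra.
  exists (1 / 3 - e); apply: avoiding_odd; rewrite // -/A; nra.
(* The second excursion keeps the length 2k + 1; the first takes up the rest of [n] and is longer,
   which yields [e < f]. *)
pose j := (n./2 - k.+1)%N.
have -> : n = ((2 * k).+1 + (2 * j).+1)%N by lia.
have AB : 4 * B <= 4 ^+ j by rewrite -exprS ler_weXn2l ?ler1n //; lia.
set A := 4 ^+ j in AB *.
have BAB : 4 * A <= 4 * (A * B) by nra.
pose d := (3 * (4 * (A * B) - 1))^-1.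
have Dd : 0 < 3 * (4 * (A * B) - 1) by lra.
have dE : d * (3 * (4 * (A * B) - 1)) = 1 by rewrite mulVf //; lra.
have d0 : 0 < d by rewrite invr_gt0.
(* The solution of the linear system f = 2Ae - 1/3, e = 2Bf - 1/3. *)
pose e := (2 * B + 1) * d; pose f := (2 * A + 1) * d.
exists (1 / 3 - e); apply: (@avoiding_even _ _ _ _ f) => //; rewrite -/A -/B.
- by rewrite mulr_gt0 //; lra.
- by rewrite ltr_pM2r //; lra.
- by rewrite /e; nra.
- by rewrite /e /f; nra.
- by rewrite /f; nra.
- by rewrite /e /f; nra.
- suff : f <= C by lra.
  rewrite /f; nra.
Qed.

(** * The symmetry x -> 1 - x *)

Lemma doublingN (R : realType) (x : R) :
  x != 1 / 2 -> doubling (1 - x) = 1 - doubling x.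
Proof.
rewrite neq_lt => /orP[h|h].
  by rewrite doubling_high ?[doubling x]doubling_low; lra.
by rewrite doubling_low ?[doubling x]doubling_high; lra.
Qed.

(** The only point where reflection fails to commute with doubling is 1/2, which lies in the hole
    and so off the orbit. *)
Lemma avoidingN (R : realType) (a b x : R) (n : nat) :
  a < 1 / 2 < b -> avoiding (1 - b) (1 - a) n x -> avoiding a b n (1 - x).
Proof.
move=> /andP[a2 b2] [x01 [n0 px lx] hx].
have it k : iter k (@doubling R) (1 - x) = 1 - iter k (@doubling R) x.
  elim: k => //= k ->; apply: doublingN.
  by apply/eqP => h; case: (hx k); rewrite h; lra.
split; [lra|split=> //|move=> k].
- by rewrite it px.
- by move=> m /lx; rewrite it; apply: contra_not => h; lra.
- by rewrite it; case: (hx k) => h; [right|left]; lra.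
Qed.

(** * Binary digits of a cycle and the trapping interval *)

Lemma iter_doubling_all_low (R : realType) (x : R) (n : nat) :
  (forall i, (i < n)%N -> iter i (@doubling R) x <= 1 / 2) ->
  iter n (@doubling R) x = 2 ^+ n * x.
Proof.
elim: n => [_|n IH h]; first by rewrite mul1r.
by rewrite iterS doubling_low ?h // IH => [|i /ltnW/h//]; rewrite exprS mulrA.
Qed.

Lemma iter_doubling_all_high (R : realType) (x : R) (n : nat) :
  (forall i, (i < n)%N -> 1 / 2 < iter i (@doubling R) x) ->
  1 - iter n (@doubling R) x = 2 ^+ n * (1 - x).
Proof.
elim: n => [_|n IH h]; first by rewrite mul1r.
rewrite iterS doubling_high ?h // exprS -mulrA -IH => [|i /ltnW/h//].
by ring.
Qed.

(** If all digits agree, [n] steps multiply the distance to the fixed point 0 or 1 by 2^n;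
    periodicity then forces [x] to be that fixed point. *)
Lemma cycle_digits (R : realType) (x : R) (n : nat) :
  (1 < n)%N -> least_period (@doubling R) n x ->
  (exists2 i, (i < n)%N & iter i (@doubling R) x <= 1 / 2) /\
  (exists2 i, (i < n)%N & 1 / 2 < iter i (@doubling R) x).
Proof.
move=> n1 [n0 px /(_ 1%N n1) /= dx].
have p2 : 1 < 2 ^+ n :> R by rewrite exprn_egt1 ?ltr1n //; lia.
split; apply: contrapT => /forall2NP h; apply: dx.
- have := @iter_doubling_all_high _ x n.
  rewrite px => /(_ _)/[!mulrBr] H.
  have -> : x = 1; last by rewrite doubling_high; lra.
  have : 1 - x = 2 ^+ n * (1 - x).
    rewrite -{1}px; apply: iter_doubling_all_high => i ni.
    by rewrite ltNge; apply/negP; case: (h i).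
  by nra.
- have -> : x = 0; last by rewrite doubling_low; lra.
  have : x = 2 ^+ n * x.
    rewrite -{1}px; apply: iter_doubling_all_low => i ni.
    by rewrite leNgt; apply/negP; case: (h i).
  by nra.
Qed.

(* [2b - 1, 2a] is forward invariant for orbits avoiding the hole, and every
   cycle enters it as soon as it has taken both binary digits. *)
Lemma avoiding_trap (R : realType) (a b x : R) (n : nat) :
  0 <= a -> a < 1 / 2 -> 1 / 2 < b -> b <= 1 -> (1 < n)%N -> avoiding a b n x ->
  forall k, 2 * b - 1 <= iter k (@doubling R) x <= 2 * a.
Proof.
move=> a0 a2 b2 b1 n1 [x01 px hx] k.
have [[i ni hi] [j nj hj]] := cycle_digits n1 px.
case: px => _ px _.
have inv m : 2 * b - 1 <= iter m (@doubling R) x ->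
    2 * b - 1 <= iter m.+1 (@doubling R) x.
  rewrite iterS; have := iter_doubling_itv m x01; case: (hx m) => h1 h2 h3.
    by rewrite doubling_low; lra.
  by rewrite doubling_high; lra.
have inv' m : iter m (@doubling R) x <= 2 * a ->
    iter m.+1 (@doubling R) x <= 2 * a.
  rewrite iterS; have := iter_doubling_itv m x01; case: (hx m) => h1 h2 h3.
    by rewrite doubling_low; lra.
  by rewrite doubling_high; lra.
have lo := @periodic_forward_invariant _ _ n j x (fun y : R => 2 * b - 1 <= y) nj px _ inv.
have up := @periodic_forward_invariant _ _ n i x (fun y : R => y <= 2 * a) ni px _ inv'.
apply/andP; split; [apply: lo|apply: up].
- by case: (hx j); lra.
- by case: (hx i); lra.
Qed.

(** * Proportion of digits 1 when b - a >= 1/4 *)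

Definition ones (R : realType) (n : nat) (x : R) : nat :=
  \sum_(i < n) (1 / 2 < iter i (@doubling R) x)%R.

Lemma onesS (R : realType) (n : nat) (x : R) :
  ones n.+1 x = (ones n x + (1 / 2 < iter n (@doubling R) x)%R)%N.
Proof. exact: big_ord_recr. Qed.

Lemma onesD (R : realType) (m n : nat) (x : R) :
  ones (m + n) x = (ones n x + ones m (iter n (@doubling R) x))%N.
Proof.
elim: m => [|m IH]; first by rewrite /ones big_ord0 addn0.
by rewrite addSn !onesS IH iterD addnA.
Qed.

Lemma onesM (R : realType) (m n : nat) (x : R) :
  iter n (@doubling R) x = x -> ones (m * n) x = (m * ones n x)%N.
Proof.
move=> px; elim: m => [|m IH]; first by rewrite /ones big_ord0.
by rewrite !mulSn (addnC n) onesD px IH.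
Qed.

(* After identifying the two ends of [2b - 1, 2a], doubling with the hole cut
   out is a monotone circle map of degree one; the invariant below says that
   its lifts stay ordered. *)
Lemma ones_balanced (R : realType) (a b x y : R) (p q n : nat) :
  1 / 4 < a < 1 / 2 -> 1 / 2 < b < 3 / 4 -> 1 / 4 <= b - a ->
  (1 < p)%N -> (1 < q)%N -> avoiding a b p x -> avoiding a b q y ->
  (ones n y <= (ones n x).+1)%N.
Proof.
move=> a4 b4 ab p1 q1 hx hy.
have tx : forall k, 2 * b - 1 <= iter k (@doubling R) x <= 2 * a.
  by apply: avoiding_trap hx => //; lra.
have ty : forall k, 2 * b - 1 <= iter k (@doubling R) y <= 2 * a.
  by apply: avoiding_trap hy => //; lra.
suff : (ones n y <= ones n x)%N \/ ones n y = (ones n x).+1 /\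
    iter n (@doubling R) y <= iter n (@doubling R) x by lia.
elim: n => [|n IH]; first by left; rewrite /ones !big_ord0.
rewrite !onesS !iterS; have := tx n; have := ty n.
move: (iter n _ x) (iter n _ y) IH => u v IH tv tu.
have [u2|u2] := leP u (1 / 2); have [v2|v2] := leP v (1 / 2);
  rewrite ?(doubling_low u2) ?(doubling_high u2)
          ?(doubling_low v2) ?(doubling_high v2) /= ?addn0 ?addn1.
- by case: IH => [|[e vu]]; [left|right; split=> //; lra].
- case: IH => [|[_ vu]]; last by lra.
  (* Here [1 / 4 <= b - a] enters: the trap has length at most 1/2, so v - u <= 1/2 and 2v - 1 <=
     2u. *)
  by rewrite leq_eqVlt => /orP[/eqP e|]; [right; split; [rewrite e|lra]|left].
- by left; case: IH => [/leqW|[-> _]].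
- by case: IH => [|[-> vu]]; [left|right; split=> //; lra].
Qed.

Lemma ones_proportional (R : realType) (a b x y : R) (p q : nat) :
  1 / 4 < a < 1 / 2 -> 1 / 2 < b < 3 / 4 -> 1 / 4 <= b - a ->
  (1 < p)%N -> (1 < q)%N -> avoiding a b p x -> avoiding a b q y ->
  (q * ones p x = p * ones q y)%N.
Proof.
move=> a4 b4 ab p1 q1 hx hy.
(* Over 2pq steps both counts are even, so differing by at most 1 makes them equal. *)
have h1 := ones_balanced (2 * q * p) a4 b4 ab p1 q1 hx hy.
have h2 := ones_balanced (2 * q * p) a4 b4 ab q1 p1 hy hx.
case: hx hy => _ [_ px _] _ [_ [_ py _] _].
move: h1 h2; rewrite (onesM _ px) -mulnA (mulnC q) mulnA (onesM _ py).
by rewrite -!mulnA; lia.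
Qed.

Lemma ones_cycle (R : realType) (x : R) (n : nat) :
  (1 < n)%N -> least_period (@doubling R) n x -> (0 < ones n x < n)%N.
Proof.
move=> n1 px; have [[i ni hi] [j nj hj]] := cycle_digits n1 px.
apply/andP; split.
  by rewrite /ones (bigD1 (Ordinal nj)) //= hj.
rewrite /ones (bigD1 (Ordinal ni)) //= ltNge hi add0n.
apply: (@leq_ltn_trans (\sum_(k < n | k != Ordinal ni) 1)%N).
  by apply: leq_sum => k _; case: (_ < _).
by rewrite sum1_card cardC1 card_ord; lia.
Qed.

Lemma D2_lt_quarter (R : realType) (a b : R) : D2 (a, b) -> b - a < 1 / 4.
Proof.
move=> /D2_eventually[[/=]]; rewrite !in_itv /= => a4 b4 [N hN].
rewrite ltNge; apply/negP => ab.
have [x hx] := hN N.+2 (leqW (leqnSn N)).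
have [y hy] := hN N.+3 (leqW (leqW (leqnSn N))).
have prop := @ones_proportional _ _ _ _ _ N.+2 N.+3 a4 b4 ab isT isT hx hy.
have : (0 < ones N.+2 x < N.+2)%N by apply: ones_cycle => //; case: hx.
have : (N.+2 %| N.+3 * ones N.+2 x)%N by rewrite prop dvdn_mulr.
rewrite Gauss_dvdr ?coprimenS // => /dvdn_leq le_ones /andP[pos_ones lt_ones].
by have := le_ones pos_ones; rewrite leqNgt lt_ones.
Qed.

(** * The hole (5/12, 7/12) *)

(* The trap is [1/6, 5/6]; off the 2-cycle {1/3, 2/3} and outside the hole,
   doubling swaps membership in (1/3, 2/3). *)
Lemma avoiding_sixth_even (R : realType) (x : R) (n : nat) :
  (2 < n)%N -> avoiding (5 / 12) (7 / 12) n x -> ~~ odd n.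
Proof.
move=> n2 hx.
have tr : forall k, 1 / 6 <= iter k (@doubling R) x <= 5 / 6.
  move=> k; suff : 2 * (7 / 12) - 1 <= iter k (@doubling R) x <= 2 * (5 / 12).
    by lra.
  by apply: avoiding_trap hx _; [lra..|exact: ltnW].
case: hx => x01 [n0 px lx] hx.
have third k : iter k (@doubling R) x != 1 / 3 /\
    iter k (@doubling R) x != 2 / 3.
  (* A point fixed by two steps would pass this on round the cycle to [x], against [2 < n]. *)
  have no : doubling (doubling (iter k (@doubling R) x)) <>
      iter k (@doubling R) x.
    move=> h; apply: (lx 2%N n2).
    apply: (@periodic_forward_invariant _ _ n (k %% n) _
      (fun y => iter 2 (@doubling R) y = y) _ px _ _ 0%N).
    - by rewrite ltn_mod.
    - by rewrite -(iter_modn_period k px).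
    - by move=> i; rewrite /= => ->.
  split; apply/eqP => e; apply: no; rewrite e.
    by rewrite (doubling_low (x := 1 / 3)) ?doubling_high; lra.
  by rewrite (doubling_high (x := 2 / 3)) ?doubling_low; lra.
pose mid k := (1 / 3 < iter k (@doubling R) x < 2 / 3).
(* (1/3, 5/12] goes to (2/3, 5/6] and [1/6, 1/3) to [1/3, 2/3), where 1/3 is excluded; the right
   half is symmetric. *)
have midS k : mid k.+1 = ~~ mid k.
  have := tr k; have := tr k.+1; have [+ +] := third k; have [+ +] := third k.+1.
  have := hx k; have := hx k.+1.
  rewrite /mid iterS; move: (iter k _ _) => y.
  have [y2|y2] := leP y (1 / 2).
    rewrite doubling_low //; lra.
  rewrite doubling_high //; lra.
have mid_odd k : mid k = odd k (+) mid 0%N.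
  by elim: k => // k IH; rewrite midS IH /= addNb.
have := mid_odd n; rewrite {1}/mid px -/(mid 0%N).
by case: (odd n); case: (mid 0%N).
Qed.

Theorem corollary3p9 (R : realType) :
  [/\ (forall a b : R, box (a, b) -> b - a < 1 / 6 -> D2 (a, b)),
      (forall c : R, 1 / 6 < c ->
         ~ (forall a b : R, box (a, b) -> b - a < c -> D2 (a, b))),
      (forall a b : R, D2 (a, b) -> b - a < 1 / 4) &
      (forall c : R, c < 1 / 4 ->
         ~ (forall a b : R, D2 (a, b) -> b - a < c))].
Proof.
split=> [a b bx ab|c c6 all|a b|c c4 all].
- apply/D2_eventually; split=> //.
  case: bx => /=; rewrite !in_itv /= => a4 b4.
  (* If b < 7/12, then a > b - 1/6 > 1/3. Otherwise a > 5/12 and b < a + 1/6 < 2/3, so the reflected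
     hole has 1 - b > 1/3 and 1 - a < 7/12. *)
  have [b7|b7] := ltP b (7 / 12).
    by apply: eventually_avoiding; lra.
  have [N hN] : exists N, forall n, (N <= n)%N ->
      exists x, avoiding (1 - b) (1 - a) n x.
    by apply: eventually_avoiding; lra.
  exists N => n /hN[x hx]; exists (1 - x); apply: avoidingN => //; lra.
- have /D2_eventually[_ [N hN]] : D2 (5 / 12 : R, 7 / 12 : R).
    by apply: all; [split; rewrite /= in_itv /=|]; lra.
  (* An odd period, at least [N] and above 2. *)
  have [x hx] := hN (2 * N + 3)%N ltac:(lia).
  have := avoiding_sixth_even _ hx; lia.
- exact: D2_lt_quarter.
(* The midpoint 13/24 of 1/2 and 7/12 keeps [b] above 1/2 when [c] is small. *)
- pose b : R := Num.max (1 / 3 + c) (13 / 24).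
  have [b1 b2] : 1 / 3 + c <= b /\ 13 / 24 <= b.
    by rewrite /b !le_max !lexx orbT.
  have b3 : b < 7 / 12 by rewrite /b gt_max; lra.
  have /all : D2 (1 / 3 : R, b); last by lra.
  apply/D2_eventually; split; first by split; rewrite /= in_itv /=; lra.
  by apply: eventually_avoiding; lra.
Qed.
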